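(* For any positive integers $n$ and $t$ with $3\leq t\leq n$, there exists a connected finite simple graph $G$ with $n$ vertices such that $\operatorname{reg}(J_G)=t$.
   Context: Let $\mathbb{K}$ be a field. For a finite simple graph $G$ on $[n]=\{1,\ldots,n\}$ with edge set $E$, the binomial edge ideal of $G$ is the ideal $J_G=(x_iy_j-x_jy_i : i<j,\ \{i,j\}\in E)$ of $S=\mathbb{K}[x_1,\ldots,x_n,y_1,\ldots,y_n]$. $\operatorname{reg}$ denotes Castelnuovo–Mumford regularity of a graded ideal (standard grading). *)

(* Defs.v *)
From HB Require Import structures.
From mathcomp Require Import all_boot all_order all_algebra.
From mathcomp.multinomials Require Import mpoly.

Set Implicit Arguments.
Unset Strict Implicit.
Unset Printing Implicit Defensive.

Import Order.TTheory GRing.Theory Num.Theory.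
Local Open Scope ring_scope.

(* Simple graphs on the vertex set 'I_n, i.e. vertices 0, ..., n - 1.         *)
Definition simple_graph (n : nat) (e : rel 'I_n) : Prop :=
  ssrbool.symmetric e /\ irreflexive e.

Definition connected_graph (n : nat) (e : rel 'I_n) : Prop :=
  (0 < n)%N /\ forall i j : 'I_n, connect e i j.

(* K[x_1, ..., x_n, y_1, ..., y_n] is {mpoly K[n + n]}: the first n variables *)
(* are the x_i, the last n are the y_i.                                       *)
Definition xvar (K : fieldType) (n : nat) (i : 'I_n) : {mpoly K[n + n]} :=
  'X_(lshift n i).

Definition yvar (K : fieldType) (n : nat) (i : 'I_n) : {mpoly K[n + n]} :=
  'X_(rshift n i).

Definition edge_binomial (K : fieldType) (n : nat) (i j : 'I_n) :
    {mpoly K[n + n]} :=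
  xvar K i * yvar K j - xvar K j * yvar K i.

Definition binomial_edge_ideal (K : fieldType) (n : nat) (e : rel 'I_n)
    (f : {mpoly K[n + n]}) : Prop :=
  exists c : 'I_n -> 'I_n -> {mpoly K[n + n]},
    f = \sum_(i < n) \sum_(j < n | (i < j)%N && e i j)
          c i j * edge_binomial K i j.

Arguments binomial_edge_ideal K {n} e f.

(* Homogeneous of (possibly negative) degree z; 0 is so for every z.          *)
Definition homog_of_deg (K : fieldType) (N : nat) (z : int)
    (f : {mpoly K[N]}) : Prop :=
  forall m : 'X_{1..N}, m \in msupp f -> (mdeg m)%:Z = z.

(* A sequence ... -> F_2 -> F_1 -> F_0 -> S of maps of free S-modules, where  *)
(* S = {mpoly K[N]} and F_p is the direct sum over k : 'I_(res_rank p) of the *)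
(* S(- res_shift k). Elements of F_p are row vectors, and maps act by right   *)
(* multiplication.                                                            *)
Record free_sequence (K : fieldType) (N : nat) := FreeSequence {
  res_rank : nat -> nat;
  res_shift : forall p : nat, 'I_(res_rank p) -> int;
  res_aug : 'cV[{mpoly K[N]}]_(res_rank 0);
  res_diff : forall p : nat, 'M[{mpoly K[N]}]_(res_rank p.+1, res_rank p)
}.

(* F is a minimal graded free resolution of the ideal I: the maps are         *)
(* homogeneous of degree 0, ... -> F_1 -> F_0 -> I -> 0 is exact, and         *)
(* the image of F_(p+1) is contained in (X_1, ..., X_N) F_p for every p.      *)
Record minimal_resolution (K : fieldType) (N : nat)
    (I : {mpoly K[N]} -> Prop) (F : free_sequence K N) : Prop :=
  MinimalResolution {
  augm_homog : forall k : 'I_(res_rank F 0),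
    homog_of_deg (res_shift k) (res_aug F k 0);
  diff_homog : forall (p : nat) (k : 'I_(res_rank F p.+1))
      (l : 'I_(res_rank F p)),
    homog_of_deg (res_shift k - res_shift l) (res_diff F p k l);
  augm_image : forall f : {mpoly K[N]},
    I f <-> exists u : 'rV[{mpoly K[N]}]_(res_rank F 0),
      f = (u *m res_aug F) 0 0;
  exact_at_0 : forall u : 'rV[{mpoly K[N]}]_(res_rank F 0),
    u *m res_aug F = 0 <->
    exists v : 'rV[{mpoly K[N]}]_(res_rank F 1), u = v *m res_diff F 0;
  exact_at_S : forall (p : nat) (u : 'rV[{mpoly K[N]}]_(res_rank F p.+1)),
    u *m res_diff F p = 0 <->
    exists v : 'rV[{mpoly K[N]}]_(res_rank F p.+2), u = v *m res_diff F p.+1;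
  diff_minimal : forall (p : nat) (k : 'I_(res_rank F p.+1))
      (l : 'I_(res_rank F p)),
    (res_diff F p k l)@_0%MM = 0
}.

(* The number of k : 'I_(res_rank F p) with res_shift k = j is the graded     *)
(* Betti number beta_(p,j), so this says                                      *)
(* reg I = max {j - p | beta_(p,j) != 0} = t. Minimal graded free resolutions *)
(* being unique up to isomorphism, the choice of F does not matter; at most   *)
(* one t satisfies the predicate, and none does for I = 0.                    *)
Definition has_regularity (K : fieldType) (N : nat)
    (I : {mpoly K[N]} -> Prop) (t : int) : Prop :=
  exists F : free_sequence K N,
    [/\ minimal_resolution I F,
        forall (p : nat) (k : 'I_(res_rank F p)), res_shift k - p%:Z <= t
      & exists (p : nat) (k : 'I_(res_rank F p)), res_shift k - p%:Z = t].

(* Main.v *)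
From HB Require Import structures.
Require Import Defs.
From mathcomp Require Import all_boot all_order all_algebra.
From mathcomp.multinomials Require Import mpoly.
From mathcomp Require Import ring zify.

(* G is a clique on m + 1 = n + 2 - t vertices with a path of t - 2 edges     *)
(* glued at its last vertex. The ideal of the clique is the ideal of maximal  *)
(* minors of a generic 2 x (m + 1) matrix; the Eagon-Northcott complex is its *)
(* minimal resolution, with shift p + 2 in degree p, so the regularity is 2.  *)
(* Each path edge {v, w} adds the quadric x_v y_w - x_w y_v, which is regular *)
(* modulo the previous ideal because x_v is and x_w, y_w are new; the mapping *)
(* cone of this quadric is again minimal and raises the regularity by 1.      *)
(*                                                                            *)
(* Exactness of the Eagon-Northcott complex: it is the total complex of a     *)
(* double complex with the Koszul differentials d_x, d_y of the two rows of   *)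
(* the matrix, and everything follows from exactness of d_x and from          *)
(* ker d_x /\ ker d_y = im (d_x d_y) in positive exterior degrees.            *)

Set Implicit Arguments.
Unset Strict Implicit.
Unset Printing Implicit Defensive.

Import Order.TTheory GRing.Theory Num.Theory.
Local Open Scope ring_scope.

(** The graph has regularity 2 plus the number of path edges. For the clique,
    [eagon_northcott_minimal] gives a linear resolution of the ideal of 2-minors. Its exactness is a
    zigzag through a double complex ([bicomplex_lift]) and rests on [koszul_exact] and
    [koszul_bicycle], both proved by removing the last column of the matrix.

    For the path, [regularity_add_generator] shows that a nonzerodivisor of degree d raises the
    regularity by d - 1, which is 1 for a quadric. That an edge binomial is a nonzerodivisor is
    [edge_nonzerodivisor]; it requires x_v to be one, which [minors_ideal_nonzerodivisor] supplies
    at the end of the clique and [new_vertex_nonzerodivisor] passes on to each new vertex.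

    All the division arguments use one device: write f = f_0 + X_v f' with f_0 free of X_v. Setting
    X_v = 0 in a relation gives a second relation, and X_v cancels from their difference. *)

(** * Splitting a polynomial by one variable *)

Section SetVarZero.
Variables (K : fieldType) (N : nat).
Implicit Types (v w : 'I_N) (f g : {mpoly K[N]}).

Definition var0 v : {mpoly K[N]} -> {mpoly K[N]} :=
  mmap (@mpolyC N K) (fun i => if i == v then 0 else 'X_i).

HB.instance Definition _ v := GRing.RMorphism.on (var0 v).

(** The quotient of f - [var0 v f] by X_v. Subtraction of exponents truncates at 0, so the filter
    keeps exactly the monomials divisible by X_v. *)
Definition divvar v f : {mpoly K[N]} :=
  \sum_(m <- msupp f | (0 < m v)%N) f@_m *: 'X_[m - U_(v)].

Lemma var0X v w : var0 v 'X_w = if w == v then 0 else 'X_w.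
Proof. by rewrite /var0 mmapX mmap1U. Qed.

Lemma var0X_id v : var0 v 'X_v = 0.
Proof. by rewrite var0X eqxx. Qed.

Lemma var0X_neq v w : w != v -> var0 v 'X_w = 'X_w.
Proof. by rewrite var0X => /negbTE->. Qed.

Lemma var0_divvar v f : f = var0 v f + 'X_v * divvar v f.
Proof.
rewrite [LHS]mpolyE /var0 /mmap /divvar mulr_sumr [X in _ + X]big_mkcond /=.
rewrite -big_split /=; apply: eq_bigr => m _.
have [m0|m_gt0] := posnP (m v).
  rewrite addr0 mul_mpolyC -mmap1_id; congr (_ *: _); apply: eq_bigr => i _.
  by case: eqP => // ->; rewrite m0 !expr0.
rewrite -scalerAr -mpolyXD addmC submK; last first.
  by apply/mnm_lepP => i; rewrite mnm1E; case: eqP => // <-.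
rewrite /mmap1 (bigD1 v) //= eqxx expr0n eqn0Ngt m_gt0 /= mul0r mulr0 add0r.
by [].
Qed.

Lemma mulXI v : injective (fun f => 'X_v * f).
Proof. by move=> f g /=; apply: mulfI; rewrite -msize_poly_eq0 msizeX. Qed.

Lemma msize_divvar v f k : (msize f <= k.+1)%N -> (msize (divvar v f) <= k)%N.
Proof.
move=> fk; rewrite /divvar; apply: leq_trans (msize_sum _ _ _) _.
apply/bigmax_leqP_seq => m mf m_gt0.
apply: leq_trans (msizeZ_le _ _) _; rewrite msizeX.
have {}mf := msize_mdeg_lt mf.
have : (U_(v) <= m)%MM.
  by apply/mnm_lepP => j; rewrite mnm1E; case: eqP => // <-.
move=> /submK/(congr1 (@mdeg N)); rewrite mdegD mdeg1.
move: fk mf => /=; lia.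
Qed.

End SetVarZero.

(** * Koszul complexes *)

Section SetVarZeroMatrix.
Variables (K : fieldType) (N : nat) (v : 'I_N).

Lemma mx_var0_divvar p q (A : 'M[{mpoly K[N]}]_(p, q)) :
  A = map_mx (var0 v) A + 'X_v *: map_mx (divvar v) A.
Proof. by apply/matrixP=> i j; rewrite !mxE -var0_divvar. Qed.

Lemma scaleXmxI p q : injective (fun A : 'M[{mpoly K[N]}]_(p, q) => 'X_v *: A).
Proof.
move=> A B /matrixP eqAB; apply/matrixP => i j; apply: (@mulXI K N v).
by have := eqAB i j; rewrite !mxE.
Qed.

Lemma map_var0_scaleX p q (A : 'M[{mpoly K[N]}]_(p, q)) :
  map_mx (var0 v) ('X_v *: A) = 0.
Proof. by rewrite map_mxZ /= var0X_id scale0r. Qed.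

(** X_v is a nonzerodivisor modulo the row space of a matrix A free of X_v: setting X_v = 0 kills
    the left side, and X_v cancels from the rest. *)
Lemma divX_mulmx p q r (b : 'M[{mpoly K[N]}]_(p, q)) (u : 'M_(p, r)) A :
    map_mx (var0 v) A = A -> 'X_v *: b = u *m A ->
  b = map_mx (divvar v) u *m A /\ map_mx (var0 v) u *m A = 0.
Proof.
move=> vA eq_b; have u0A: map_mx (var0 v) u *m A = 0.
  by rewrite -[in LHS]vA -map_mxM -eq_b map_var0_scaleX.
split=> //; apply: scaleXmxI; rewrite /= eq_b [in LHS](mx_var0_divvar u).
by rewrite mulmxDl u0A add0r scalemxAl.
Qed.

End SetVarZeroMatrix.

(* binomial(m, q), with a recursion that makes both ext_rank 0 m = 1 and      *)
(* Pascal's rule hold by conversion.                                          *)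
Fixpoint ext_rank (q : nat) : nat -> nat :=
  if q is q'.+1 then
    fix ext_rank_q (m : nat) : nat :=
      if m is m'.+1 then (ext_rank_q m' + ext_rank q' m')%N else 0%N
  else fun=> 1%N.

Arguments ext_rank : simpl never.

Section Koszul.
Variable R : comNzRingType.
Implicit Types (z w : nat -> R) (m q : nat).

(* Splitting the subsets of {0, ..., m} according to whether they contain m,  *)
(* the differential is (a, b) |-> (a d + z_m b, - b d).                       *)
Fixpoint koszul z m : forall q, 'M[R]_(ext_rank q.+1 m, ext_rank q m) :=
  match m return forall q, 'M[R]_(ext_rank q.+1 m, ext_rank q m) with
  | 0 => fun q => 0
  | m'.+1 => fun q =>
      match q return 'M[R]_(ext_rank q.+1 m'.+1, ext_rank q m'.+1) with
      | 0 => @col_mx R (ext_rank 1 m') (ext_rank 0 m') (ext_rank 0 m')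
               (koszul z m' 0) (z m')%:M
      | q'.+1 => @block_mx R (ext_rank q'.+2 m') (ext_rank q'.+1 m')
                   (ext_rank q'.+1 m') (ext_rank q' m')
                   (koszul z m' q'.+1) 0 (z m')%:M (- koszul z m' q')
      end
  end.

Lemma ext_split q m (P : 'rV[R]_(ext_rank q.+1 m.+1) -> Prop) :
  (forall (a : 'rV_(ext_rank q.+1 m)) (b : 'rV_(ext_rank q m)),
     P (row_mx a b)) -> forall u, P u.
Proof.
move=> Pab u; have := Pab (lsubmx (u : 'rV_(ext_rank q.+1 m + _)))
  (rsubmx (u : 'rV_(ext_rank q.+1 m + _))).
by rewrite hsubmxK.
Qed.

Lemma koszul_row0 z m (a : 'rV_(ext_rank 1 m)) (b : 'rV_1) :
  (row_mx a b : 'rV_(ext_rank 1 m.+1)) *m koszul z m.+1 0 =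
  a *m koszul z m 0 + z m *: b.
Proof. by rewrite /= mul_row_col mul_mx_scalar. Qed.

Lemma koszul_rowS z m q
    (a : 'rV_(ext_rank q.+2 m)) (b : 'rV_(ext_rank q.+1 m)) :
  (row_mx a b : 'rV_(ext_rank q.+2 m.+1)) *m koszul z m.+1 q.+1 =
  row_mx (a *m koszul z m q.+1 + z m *: b) (- (b *m koszul z m q)).
Proof. by rewrite /= mul_row_block mul_mx_scalar mulmx0 add0r mulmxN. Qed.

Lemma koszul_sq z m q : koszul z m q.+1 *m koszul z m q = 0.
Proof.
elim: m q => [|m IHm] [|q] /=; do ?by rewrite mulmx0.
- rewrite mul_block_col (IHm 0) mul0mx addr0 mul_scalar_mx mulNmx mul_mx_scalar.
  by rewrite subrr col_mx0.
rewrite mulmx_block (IHm q.+1) mul0mx mulmx0 !addr0 mul_scalar_mx.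
rewrite mul_mx_scalar scalerN subrr mul0mx add0r mulNmx mulmxN opprK (IHm q).
rewrite mulmx0 addr0.
exact: block_mx0.
Qed.

(** This is the polarisation of d^2 = 0, since the Koszul differential is linear in z. *)
Lemma koszul_anticomm z w m q :
  koszul z m q.+1 *m koszul w m q = - (koszul w m q.+1 *m koszul z m q).
Proof.
elim: m q => [|m IHm] [|q] /=; do ?by rewrite !mulmx0 oppr0.
- rewrite !mul_block_col !mul0mx !addr0 !mul_scalar_mx !mulNmx !mul_mx_scalar.
  by rewrite opp_col_mx (IHm 0) opprB.
rewrite !mulmx_block !mul0mx !mulmx0 !addr0 !mul_scalar_mx !mulNmx !mulmxN.
rewrite !mul_mx_scalar !opprK opp_block_mx opprB oppr0 !add0r.
by rewrite (IHm q.+1) (IHm q).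
Qed.

Lemma eq_koszul z w m q :
  (forall i, (i < m)%N -> z i = w i) -> koszul z m q = koszul w m q.
Proof.
elim: m q => [|m IHm] [|q] eq_zw //=; rewrite eq_zw // !IHm // => i im;
  by rewrite eq_zw // ltnS ltnW.
Qed.

End Koszul.

Lemma map_koszul (R R' : comNzRingType) (f : {rmorphism R -> R'}) z m q :
  map_mx f (koszul z m q) = koszul (f \o z) m q.
Proof.
elim: m q => [|m IHm] [|q] /=; rewrite ?map_mx0 //.
  by rewrite map_col_mx (IHm 0) map_scalar_mx.
by rewrite map_block_mx map_mxN (IHm q.+1) (IHm q) map_scalar_mx map_mx0.
Qed.

Lemma koszul_row_eq0 (R : comNzRingType) (z : nat -> R) m q
    (a : 'rV_(ext_rank q.+1 m)) (b : 'rV_(ext_rank q m)) :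
    (row_mx a b : 'rV_(ext_rank q.+1 m.+1)) *m koszul z m.+1 q = 0 ->
  a *m koszul z m q = - (z m *: b).
Proof.
case: q a b => [|q] a b.
  by rewrite koszul_row0 => /eqP; rewrite addr_eq0 => /eqP.
rewrite koszul_rowS -row_mx0 => /eq_row_mx[/eqP].
by rewrite addr_eq0 => /eqP.
Qed.

Section KoszulVariables.
Variables (K : fieldType) (N : nat).
Implicit Types (v w : 'I_N) (vx vy : nat -> 'I_N).
Local Notation kos vx := (koszul (fun i => 'X_(vx i) : {mpoly K[N]})).

Lemma var0_koszul v vx m q : (forall i, (i < m)%N -> vx i != v) ->
  map_mx (var0 v) (kos vx m q) = kos vx m q.
Proof.
move=> vxv; rewrite map_koszul; apply: eq_koszul => i im /=.
by rewrite var0X_neq ?vxv.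
Qed.

(** For a cycle (a, b), the component b is a boundary c d: by induction or, in exterior degree 0, by
    dividing X_m out of a d = - X_m b. Then a + X_m c is a cycle in the remaining variables. *)
Lemma koszul_exact vx m q (u : 'rV_(ext_rank q.+1 m)) :
    (forall i j, (i < j < m)%N -> vx i != vx j) -> u *m kos vx m q = 0 ->
  exists c, u = c *m kos vx m q.+1.
Proof.
elim: m q u => [|m IHm] q u vx_inj; first by exists 0; apply/rowP => -[].
elim/ext_split: u => a b ab0.
have IH q' (u' : 'rV_(ext_rank q'.+1 m)) : u' *m kos vx m q' = 0 ->
    exists c, u' = c *m kos vx m q'.+1.
  by apply: (IHm q' u') => i j /andP[ij jm]; rewrite vx_inj // ij ltnW.
have eq_a := koszul_row_eq0 ab0.
have [c eq_b] : exists c, b = c *m kos vx m q.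
  case: q a b ab0 eq_a => [|q] a b ab0 eq_a.
    have [] := @divX_mulmx K N (vx m) _ _ _ b (- a) (kos vx m 0).
    - by apply: var0_koszul => i im; rewrite vx_inj // im ltnS leqnn.
    - by rewrite mulNmx eq_a opprK.
    by move=> eq_b _; exists (map_mx (divvar (vx m)) (- a)).
  move: ab0; rewrite koszul_rowS -row_mx0 => /eq_row_mx[_ /eqP].
  by rewrite oppr_eq0 => /eqP/IH.
have [e eq_e] : exists e, a + 'X_(vx m) *: c = e *m kos vx m q.+1.
  by apply: IH; rewrite mulmxDl eq_a eq_b scalemxAl addNr.
exists (row_mx e (- c)); rewrite koszul_rowS mulNmx opprK -eq_b -eq_e.
by rewrite scalerN addrK.
Qed.

(* Setting X_v = 0 turns the first relation into a Koszul relation, and       *)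
(* subtracting it leaves relations divisible by X_v: induct on the degree     *)
(* of b.                                                                      *)
Lemma column_ideal_transfer vx vy m v w
    (a : 'rV_(ext_rank 1 m)) (b : 'rV_(ext_rank 0 m)) :
    (forall i j, (i < j < m)%N -> vx i != vx j) ->
    (forall i, (i < m)%N -> [/\ vx i != v, vy i != v, vx i != w & vy i != w]) ->
    v != w ->
    'X_v *: b = a *m kos vx m 0 -> 'X_w *: b = a *m kos vy m 0 ->
  exists c, b = c *m kos vx m 1 *m kos vy m 0.
Proof.
move=> vx_inj new neq_vw.
move: {2}(msize (b 0 0)) (leqnn (msize (b 0 0))) => k.
elim: k a b => [|k IHk] a b bk eq_x eq_y.
  exists 0; rewrite !mul0mx; apply/rowP => j; rewrite ord1 mxE; apply/eqP.
  by rewrite -msize_poly_eq0 -leqn0.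
have vX q : map_mx (var0 v) (kos vx m q) = kos vx m q.
  by apply: var0_koszul => i /new[].
have vY q : map_mx (var0 v) (kos vy m q) = kos vy m q.
  by apply: var0_koszul => i /new[].
have wX q : map_mx (var0 w) (kos vx m q) = kos vx m q.
  by apply: var0_koszul => i /new[].
have wY q : map_mx (var0 w) (kos vy m q) = kos vy m q.
  by apply: var0_koszul => i /new[].
have [eq_b /(koszul_exact vx_inj)[c eq_c]] := divX_mulmx (vX 0) eq_x.
have eq_wb0 : 'X_w *: map_mx (var0 v) b = map_mx (var0 v) a *m kos vy m 0.
  by rewrite -[in RHS]vY -map_mxM -eq_y map_mxZ /= var0X_neq // eq_sym.
have [] := @divX_mulmx K N w _ _ _ (map_mx (var0 v) b) c
  (kos vx m 1 *m kos vy m 0).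
- by rewrite map_mxM wX wY.
- by rewrite mulmxA -eq_c.
set c' := map_mx _ c => eq_b0 _.
set a' := map_mx (divvar v) a in eq_b.
set b' := map_mx (divvar v) b.
have eq_a' : a' *m kos vy m 0 = 'X_w *: b'.
  apply: (@scaleXmxI K N v) => /=; apply: (addrI ('X_w *: map_mx (var0 v) b)).
  rewrite {1}eq_wb0 scalemxAl -mulmxDl -mx_var0_divvar -eq_y.
  by rewrite scalerA mulrC -scalerA -scalerDr -mx_var0_divvar.
(* Adding c' d_y to a' removes b_0 = c' d_x d_y from the first relation by anticommutation, and
   leaves the second unchanged as d_y d_y = 0. *)
have [||| c'' eq_b'] := IHk (a' + c' *m kos vy m 1) b'.
- by rewrite mxE msize_divvar.
- rewrite mulmxDl -eq_b -mulmxA koszul_anticomm mulmxN -eq_b0.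
  by rewrite {1}[b](mx_var0_divvar v) addrAC subrr add0r.
- by rewrite mulmxDl -mulmxA koszul_sq mulmx0 addr0 eq_a'.
exists (c' + 'X_v *: c''); rewrite {1}[b](mx_var0_divvar v) !mulmxDl.
by rewrite eq_b0 -/b' eq_b' mulmxA !scalemxAl.
Qed.

(** The induction is that of [koszul_exact], with [column_ideal_transfer] taking over in exterior
    degree 0. *)
Lemma koszul_bicycle vx vy m q (u : 'rV_(ext_rank q.+1 m)) :
    (forall i j, (i < j < m)%N -> vx i != vx j) ->
    (forall i j, (i < j < m)%N -> vy i != vy j) ->
    (forall i j, (i < m)%N -> (j < m)%N -> vx i != vy j) ->
    u *m kos vx m q = 0 -> u *m kos vy m q = 0 ->
  exists c, u = c *m kos vx m q.+2 *m kos vy m q.+1.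
Proof.
elim: m q u => [|m IHm] q u vx_inj vy_inj vxy.
  by exists 0; apply/rowP => -[].
elim/ext_split: u => a b abx aby.
have IH q' (u' : 'rV_(ext_rank q'.+1 m)) :
    u' *m kos vx m q' = 0 -> u' *m kos vy m q' = 0 ->
    exists c, u' = c *m kos vx m q'.+2 *m kos vy m q'.+1.
  apply: (IHm q' u') => i j; last by move=> im jm; rewrite vxy // ltnW.
    by move=> /andP[ij jm]; rewrite vx_inj // ij ltnW.
  by move=> /andP[ij jm]; rewrite vy_inj // ij ltnW.
have eq_ax := koszul_row_eq0 abx; have eq_ay := koszul_row_eq0 aby.
have [c eq_b] : exists c, b = c *m kos vx m q.+1 *m kos vy m q.
  case: q a b abx aby eq_ax eq_ay => [|q] a b abx aby eq_ax eq_ay.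
    apply: (@column_ideal_transfer vx vy m (vx m) (vy m) (- a)).
    - by move=> i j /andP[ij jm]; rewrite vx_inj // ij ltnW.
    - move=> i im; split; rewrite ?vx_inj ?vy_inj ?im ?ltnSn //.
        by rewrite eq_sym vxy // ltnW.
      by rewrite vxy // ltnW.
    - by rewrite vxy.
    - by rewrite mulNmx eq_ax opprK.
    - by rewrite mulNmx eq_ay opprK.
  move: abx aby; rewrite !koszul_rowS -!row_mx0.
  move=> /eq_row_mx[_ /eqP]; rewrite oppr_eq0 => /eqP bx.
  move=> /eq_row_mx[_ /eqP]; rewrite oppr_eq0 => /eqP by0.
  exact: IH.
have [cx eq_cx] : exists cx, cx = c *m kos vx m q.+1 by eexists.
have [cy eq_cy] : exists cy, cy = c *m kos vy m q.+1 by eexists.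
have cxx : cx *m kos vx m q = 0 by rewrite eq_cx -mulmxA koszul_sq mulmx0.
have cyy : cy *m kos vy m q = 0 by rewrite eq_cy -mulmxA koszul_sq mulmx0.
have cxy : cx *m kos vy m q = b by rewrite eq_cx eq_b.
have cyx : cy *m kos vx m q = - b.
  by rewrite eq_cy -mulmxA koszul_anticomm mulmxN mulmxA eq_b.
(* As c d_x d_y = b and c d_y d_x = - b, this correction of a is killed by both differentials. *)
have [||e eq_e] := IH _ (a - 'X_(vx m) *: cy + 'X_(vy m) *: cx).
- rewrite mulmxDl mulmxBl -!scalemxAl cxx cyx eq_ax.
  by rewrite scaler0 addr0 scalerN opprK addNr.
- rewrite mulmxDl mulmxBl -!scalemxAl cyy cxy eq_ay.
  by rewrite scaler0 subr0 addNr.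
exists (row_mx e c); rewrite !koszul_rowS -eq_cx mulNmx opprK cxy.
rewrite mulmxDl -eq_e -scalemxAl -eq_cy scalerN.
by rewrite [_ + _ *: cx]addrAC addrNK addrK.
Qed.

End KoszulVariables.

(** * The Eagon-Northcott resolution *)

Section Homogeneous.
Variables (K : fieldType) (N : nat).
Implicit Types (f g : {mpoly K[N]}) (z : int).

Lemma homog0 z : homog_of_deg z (0 : {mpoly K[N]}).
Proof. by move=> m; rewrite msupp0. Qed.

Lemma homog1 : homog_of_deg 0 (1 : {mpoly K[N]}).
Proof. by move=> m; rewrite msupp1 inE => /eqP->; rewrite mdeg0. Qed.

Lemma homogX i : homog_of_deg 1 ('X_i : {mpoly K[N]}).
Proof. by move=> m; rewrite msuppX inE => /eqP->; rewrite mdeg1. Qed.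

Lemma homogD z f g :
  homog_of_deg z f -> homog_of_deg z g -> homog_of_deg z (f + g).
Proof. by move=> zf zg m /msuppD_le; rewrite mem_cat => /orP[/zf|/zg]. Qed.

Lemma homogN z f : homog_of_deg z f -> homog_of_deg z (- f).
Proof. by move=> zf m; rewrite (perm_mem (msuppN f)) => /zf. Qed.

Lemma homogM z z' f g :
  homog_of_deg z f -> homog_of_deg z' g -> homog_of_deg (z + z') (f * g).
Proof.
move=> zf zg m /msuppM_le/allpairsP[[m1 m2] /= [/zf <- /zg <- ->]].
by rewrite mdegD PoszD.
Qed.

Lemma homog_sum z (I : finType) (F : I -> {mpoly K[N]}) :
  (forall i, homog_of_deg z (F i)) -> homog_of_deg z (\sum_i F i).
Proof.
by move=> zF; apply: big_ind => //; [exact: homog0 | exact: homogD].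
Qed.

Lemma homog_mcoeff0 z f : homog_of_deg z f -> z != 0 -> f@_0%MM = 0.
Proof.
move=> zf z0; apply/memN_msupp_eq0/negP => /zf; rewrite mdeg0 => /esym/eqP.
exact/negP.
Qed.

Definition homog_mx z p q (A : 'M[{mpoly K[N]}]_(p, q)) :=
  forall i j, homog_of_deg z (A i j).

Lemma homog_mxD z p q (A B : 'M_(p, q)) :
  homog_mx z A -> homog_mx z B -> homog_mx z (A + B).
Proof. by move=> zA zB i j; rewrite mxE; apply: homogD. Qed.

Lemma homog_mxM z z' p q r (A : 'M_(p, q)) (B : 'M_(q, r)) :
  homog_mx z A -> homog_mx z' B -> homog_mx (z + z') (A *m B).
Proof.
by move=> zA zB i j; rewrite mxE; apply: homog_sum => k; apply: homogM.
Qed.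

Lemma homog_delta_mx p q (i : 'I_p) (j : 'I_q) : homog_mx 0 (delta_mx i j).
Proof.
by move=> i' j'; rewrite mxE; case: (_ && _); [exact: homog1 | exact: homog0].
Qed.

Lemma homog_koszul (v : nat -> 'I_N) m q :
  homog_mx 1 (koszul (fun i => 'X_(v i)) m q).
Proof.
elim: m q => [|m IHm] q /=; first by move=> i j; rewrite mxE; apply: homog0.
have zX p : homog_mx 1 (('X_(v m))%:M : 'M[{mpoly K[N]}]_p).
  by move=> i j; rewrite mxE; case: eqP => _; [exact: homogX | exact: homog0].
case: q => [|q].
  by move=> i j; rewrite mxE; case: split => k; [exact: IHm | exact: zX].
move=> i j; rewrite mxE; case: split => k; rewrite mxE; case: split => l.
- exact: IHm.
- by rewrite mxE; apply: homog0.
- exact: zX.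
- by rewrite mxE; apply/homogN/IHm.
Qed.

Lemma homog_lin_mx z p q r s (f : 'M[{mpoly K[N]}]_(p, q) -> 'M_(r, s)) :
  (forall i j, homog_mx z (f (delta_mx i j))) -> homog_mx z (lin_mx f).
Proof.
move=> zf k l; case/mxvec_indexP: k => i j; case/mxvec_indexP: l => i' j'.
by rewrite mxE /= vec_mx_delta mxvecE; apply: zf.
Qed.

End Homogeneous.

Lemma mxvec11 (R : Type) (B : 'M[R]_1) : mxvec B = B :> 'rV_1.
Proof.
apply/rowP => j; rewrite ord1 -[RHS]mxvecE.
by congr (mxvec _ _ _); apply/val_inj; case: (mxvec_index _ _) => -[].
Qed.

Section EagonNorthcott.
Variables (R : comNzRingType) (r : nat -> nat).
Variables dx dy : forall q, 'M[R]_(r q.+1, r q).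

Section Maps.
Variables p q : nat.

(* The rows are the coefficients on the basis of the divided power of the     *)
(* rank 2 module, so that row k of the image is w_(k+1) dx + w_k dy.          *)
Definition en_map (W : 'M_(p.+2, r q.+1)) : 'M_(p.+1, r q) :=
  row' ord0 W *m dx q + row' ord_max W *m dy q.

Lemma en_map_is_linear : linear en_map.
Proof.
move=> a A B; rewrite /en_map !linearP /= !mulmxDl -!scalemxAl scalerDr.
by rewrite addrACA.
Qed.

HB.instance Definition _ :=
  GRing.isLinear.Build _ _ _ _ en_map en_map_is_linear.

Lemma row_en_map W k :
  row k (en_map W) =
  row (lift ord0 k) W *m dx q + row (lift ord_max k) W *m dy q.
Proof.
apply/rowP => j; rewrite !mxE.
by congr (_ + _); apply: eq_bigr => i _; rewrite !mxE.
Qed.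

End Maps.

(** For the Koszul differentials of two rows, the coefficients of this composite are the 2-minors up
    to sign. *)
Definition en_aug (W : 'M_(1, r 2)) : 'M_(1, r 0) := W *m dx 1 *m dy 0.

Lemma en_aug_is_linear : linear en_aug.
Proof. by move=> a A B; rewrite /en_aug !mulmxDl -!scalemxAl. Qed.

HB.instance Definition _ :=
  GRing.isLinear.Build _ _ _ _ en_aug en_aug_is_linear.

Hypothesis dx_sq : forall q, dx q.+1 *m dx q = 0.
Hypothesis dy_sq : forall q, dy q.+1 *m dy q = 0.
Hypothesis dyx : forall q, dy q.+1 *m dx q = - (dx q.+1 *m dy q).

(** Row j is v_(j+2) d_x d_x + v_(j+1) (d_y d_x + d_x d_y) + v_j d_y d_y, and each term vanishes. *)
Lemma en_map_sq p q (V : 'M_(p.+3, r q.+2)) : en_map (en_map V) = 0.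
Proof.
apply/row_matrixP => j; rewrite row0 !row_en_map !mulmxDl -!mulmxA.
rewrite dx_sq dy_sq !mulmx0 add0r addr0 dyx mulmxN.
set k := lift ord_max _; set l := lift ord0 _.
suff -> : k = l by rewrite addNr.
by apply/ord_inj; rewrite lift_max !lift0 lift_max.
Qed.

Lemma en_aug_map (V : 'M_(2, r 3)) : en_aug (en_map V) = 0.
Proof.
rewrite /en_aug /en_map !mulmxDl -!mulmxA [dx 2 *m _]mulmxA dx_sq mul0mx.
rewrite mulmx0 add0r [dy 2 *m _]mulmxA dyx mulNmx -mulmxA dy_sq.
by rewrite !(mulmx0, oppr0).
Qed.

Hypothesis dx_exact : forall q (u : 'rV_(r q.+1)),
  u *m dx q = 0 -> exists c, u = c *m dx q.+1.
Hypothesis dxy_exact : forall q (u : 'rV_(r q.+1)),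
  u *m dx q = 0 -> u *m dy q = 0 -> exists c, u = c *m dx q.+2 *m dy q.+1.

(** A zigzag: w_0 d_x lies in both kernels, so it is z d_x d_y, and v_0 = - z. Each v_(j+1) is then
    a preimage under d_x of w_j - v_j d_y, which is a d_x-cycle by anticommutation. *)
Lemma bicomplex_lift q p (w : nat -> 'rV_(r q.+2)) :
    w 0 *m dx q.+1 *m dy q = 0 ->
    (forall j, (j < p)%N -> w j.+1 *m dx q.+1 + w j *m dy q.+1 = 0) ->
  exists v : nat -> 'rV_(r q.+3), forall j, (j <= p)%N ->
    w j = v j.+1 *m dx q.+2 + v j *m dy q.+2.
Proof.
move=> w0 wS; suff: forall k, (k <= p)%N ->
    exists v : nat -> 'rV_(r q.+3), forall j, (j <= k)%N ->
    w j = v j.+1 *m dx q.+2 + v j *m dy q.+2 by apply.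
elim=> [_|k IHk kp].
  have [||z eq_z] := dxy_exact (u := w 0 *m dx q.+1).
  - by rewrite -mulmxA dx_sq mulmx0.
  - exact: w0.
  have [|v1 eq_v1] := dx_exact (u := w 0 + z *m dy q.+2).
    rewrite mulmxDl eq_z -[z *m dy _ *m _]mulmxA dyx.
    by rewrite mulmxN mulmxA subrr.
  exists (fun j => if j is 0 then - z else v1) => j; rewrite leqn0 => /eqP->.
  by rewrite -eq_v1 mulNmx addrK.
have [v eq_v] := IHk (ltnW kp).
have [|c eq_c] := dx_exact (u := w k.+1 - v k.+1 *m dy q.+2).
  have /eqP := wS k kp; rewrite addr_eq0 mulmxBl => /eqP->.
  rewrite (eq_v k) // mulmxDl -!mulmxA dy_sq mulmx0 addr0.
  by rewrite dyx mulmxN opprK addNr.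
exists (fun j => if j == k.+2 then c else v j) => j; rewrite leq_eqVlt.
case/orP=> [/eqP->|jk].
  by rewrite eqxx -eq_c (ltn_eqF (ltnSn _)) subrK.
by rewrite eqSS !ltn_eqF ?eq_v // ltnW.
Qed.

Lemma en_map_lift p q (W : 'M_(p.+1, r q.+2)) :
    row ord0 W *m dx q.+1 *m dy q = 0 ->
    (forall j j' : 'I_p.+1, j' = j.+1 :> nat ->
      row j' W *m dx q.+1 + row j W *m dy q.+1 = 0) ->
  exists V : 'M_(p.+2, r q.+3), W = en_map V.
Proof.
move=> W0 WS.
have [||v eq_v] := @bicomplex_lift q p (fun j => row (inord j) W).
- by rewrite -[inord 0]/(inord (@ord0 p)) inord_val.
- by move=> j jp; apply: WS; rewrite !inordK // ltnW.
exists (\matrix_j v j); apply/row_matrixP => j.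
by rewrite row_en_map !rowK lift0 lift_max -eq_v ?inord_val // -ltnS.
Qed.

Lemma en_aug_exact (W : 'M_(1, r 2)) :
  en_aug W = 0 <-> exists V : 'M_(2, r 3), W = en_map V.
Proof.
split=> [W0|[V ->]]; last exact: en_aug_map.
apply: en_map_lift => [|j j']; last by rewrite !ord1.
by rewrite -[row _ W](_ : W = _) //; apply/rowP => j; rewrite mxE.
Qed.

Lemma en_map_exact p q (W : 'M_(p.+2, r q.+3)) :
  en_map W = 0 <-> exists V : 'M_(p.+3, r q.+4), W = en_map V.
Proof.
split=> [W0|[V ->]]; last exact: en_map_sq.
have WS (j j' : 'I_p.+2) : j' = j.+1 :> nat ->
    row j' W *m dx q.+2 + row j W *m dy q.+2 = 0.
  move=> eq_j'; have jp : (j < p.+1)%N by rewrite -ltnS -eq_j'.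
  have := congr1 (row (Ordinal jp)) W0; rewrite row_en_map row0 => <-.
  by congr (row _ W *m _ + row _ W *m _); apply/val_inj;
    rewrite /= ?eq_j' /bump ?leq0n // leqNgt jp.
apply: en_map_lift => //.
(* The zigzag starts from w_0 d_x d_y = 0; this holds because w_0 d_x d_y = - w_0 d_y d_x = w_1 d_x
   d_x by the first row relation. *)
have := WS ord0 (inord 1) (inordK _); rewrite addrC => /(_ isT)/eqP.
rewrite addr_eq0 => /eqP W1.
rewrite -mulmxA -[dx _ *m _]opprK -dyx mulmxN mulmxA W1 mulNmx opprK.
by rewrite -mulmxA dx_sq mulmx0.
Qed.

Lemma en_diff_exact p q (u : 'rV_(p.+2 * r q.+3)) :
  u *m lin_mx (@en_map p q.+2) = 0 <->
  exists v, u = v *m lin_mx (@en_map p.+1 q.+3).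
Proof.
rewrite -[u]vec_mxK mul_vec_lin.
have [lift sq] := en_map_exact (vec_mx u); split=> [|[v eq_u]].
  rewrite -[RHS](linear0 mxvec) => /(can_inj mxvecK)/lift[V ->].
  by exists (mxvec V); rewrite mul_vec_lin.
rewrite -[RHS](linear0 mxvec); congr mxvec; apply: sq; exists (vec_mx v).
by apply: (can_inj mxvecK); rewrite eq_u -{1}[v]vec_mxK mul_vec_lin.
Qed.

Lemma en_aug_exact_vec (u : 'rV_(1 * r 2)) :
  en_aug (vec_mx u) = 0 <-> exists v, u = v *m lin_mx (@en_map 0 2).
Proof.
rewrite en_aug_exact; split=> [[V eq_u]|[v ->]].
  by exists (mxvec V); rewrite mul_vec_lin -[u]vec_mxK eq_u.
by exists (vec_mx v); rewrite -{1}[v]vec_mxK mul_vec_lin mxvecK.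
Qed.

End EagonNorthcott.

Section EagonNorthcottResolution.
Variables (K : fieldType) (N : nat) (vx vy : nat -> 'I_N) (m : nat).
Local Notation kos v := (koszul (fun i => 'X_(v i) : {mpoly K[N]}) m).

(** Degree p is the p-th divided power of a rank 2 module tensored with the exterior power p + 2,
    flattened by [mxvec]. The augmentation is quadratic and the differentials are linear, hence the
    shift p + 2. *)
Definition eagon_northcott : free_sequence K N := {|
  res_rank := fun p => (p.+1 * ext_rank p.+2 m)%N;
  res_shift := fun p _ => Posz p.+2;
  res_aug := lin_mx (en_aug (r := ext_rank^~ m) (kos vx) (kos vy));
  res_diff := fun p =>
    lin_mx (en_map (r := ext_rank^~ m) (p := p) (q := p.+2)
      (kos vx) (kos vy)) |}.

Lemma homog_en_map p q W : homog_mx 0 W ->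
  homog_mx 1 (en_map (r := ext_rank^~ m) (p := p) (q := q) (kos vx) (kos vy) W).
Proof.
move=> zW; rewrite -[1]add0r; apply: homog_mxD; apply: homog_mxM;
  by [move=> i j; rewrite mxE; exact: zW | exact: homog_koszul].
Qed.

Hypothesis vx_inj : forall i j, (i < j < m)%N -> vx i != vx j.
Hypothesis vy_inj : forall i j, (i < j < m)%N -> vy i != vy j.
Hypothesis vxy : forall i j, (i < m)%N -> (j < m)%N -> vx i != vy j.

Lemma eagon_northcott_minimal :
  minimal_resolution
    (fun f => exists w : 'rV_(ext_rank 2 m),
       f = (w *m kos vx 1 *m kos vy 0) 0 0)
    eagon_northcott.
Proof.
have homog_diff p : homog_mx 1 (res_diff eagon_northcott p).
  by apply: homog_lin_mx => i j; apply/homog_en_map/homog_delta_mx.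
have exX q (u : 'rV[{mpoly K[N]}]_(ext_rank q.+1 m)) :=
  koszul_exact (u := u) vx_inj.
have exXY q (u : 'rV[{mpoly K[N]}]_(ext_rank q.+1 m)) := 
  koszul_bicycle (u := u) vx_inj vy_inj vxy.
have sqX := koszul_sq (fun i => 'X_(vx i) : {mpoly K[N]}) m.
have sqY := koszul_sq (fun i => 'X_(vy i) : {mpoly K[N]}) m.
have anti := koszul_anticomm (fun i => 'X_(vy i) : {mpoly K[N]})
  (fun i => 'X_(vx i)) m.
have mul_aug u : u *m res_aug eagon_northcott =
    en_aug (r := ext_rank^~ m) (kos vx) (kos vy) (vec_mx u).
  rewrite -{1}[u]vec_mxK -[RHS]mxvec11.
  exact: (mul_vec_lin (@en_aug _ (ext_rank^~ m) (kos vx) (kos vy))).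
split.
- move=> k; rewrite (_ : res_shift _ = 0 + 1 + 1) //.
  apply: homog_lin_mx => i j.
  do 2![apply: homog_mxM; last exact: homog_koszul]; exact: homog_delta_mx.
- move=> p k l; rewrite (_ : res_shift k - res_shift l = 1) /=; last by lia.
  exact: homog_diff.
- move=> f; split=> [[w ->] | [u ->]].
    by exists (mxvec w); rewrite mul_aug mxvecK.
  by exists (vec_mx u); rewrite mul_aug.
- move=> u; rewrite mul_aug.
  exact: (@en_aug_exact_vec _ (ext_rank^~ m)).
- move=> p u; exact: (@en_diff_exact _ (ext_rank^~ m)).
- by move=> p k l; apply: (homog_mcoeff0 (homog_diff p k l)).
Qed.

End EagonNorthcottResolution.

(** * Adding a regular generator *)

Section Cone.
Variables (K : fieldType) (N : nat).
Implicit Types (I : {mpoly K[N]} -> Prop) (f : {mpoly K[N]}).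

Definition add_generator I f : {mpoly K[N]} -> Prop :=
  fun h => exists i g, I i /\ h = i + g * f.

Definition nonzerodivisor I f := forall g, I (f * g) -> I g.

Variables (F : free_sequence K N) (f : {mpoly K[N]}) (d : int).

(** F resolves I rather than S/I, so the module S before [F_0] is implicit; its copy shifted by d is
    the summand of rank 1 in degree 0. *)
Definition cone_rank (p : nat) : nat :=
  if p is p'.+1 then (res_rank F p'.+1 + res_rank F p')%N
  else (res_rank F 0 + 1)%N.

Definition cone_shift (p : nat) : 'I_(cone_rank p) -> int :=
  match p with
  | 0 => fun k => if split k is inl i then res_shift i else d
  | p'.+1 => fun k =>
      match split k with inl i => res_shift i | inr j => res_shift j + d end
  end.

Definition cone_diff (p : nat) :
    'M[{mpoly K[N]}]_(cone_rank p.+1, cone_rank p) :=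
  match p with
  | 0 => block_mx (res_diff F 0) 0 f%:M (- res_aug F)
  | p'.+1 => block_mx (res_diff F p'.+1) 0 f%:M (- res_diff F p')
  end.

(* The mapping cone of multiplication by f on F, seen as a resolution of S/I. *)
Definition cone : free_sequence K N :=
  FreeSequence cone_shift (col_mx (res_aug F) f%:M) cone_diff.

Lemma cone_row_aug (a : 'rV_(res_rank F 0)) (b : 'rV_1) :
  (row_mx a b : 'rV_(cone_rank 0)) *m res_aug cone = a *m res_aug F + f *: b.
Proof. by rewrite /= mul_row_col mul_mx_scalar. Qed.

Lemma cone_row_diff0 (a : 'rV_(res_rank F 1)) (b : 'rV_(res_rank F 0)) :
  (row_mx a b : 'rV_(cone_rank 1)) *m res_diff cone 0 =
  row_mx (a *m res_diff F 0 + f *: b) (- (b *m res_aug F)).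
Proof. by rewrite /= mul_row_block mul_mx_scalar mulmx0 add0r mulmxN. Qed.

Lemma cone_row_diffS p (a : 'rV_(res_rank F p.+2)) (b : 'rV_(res_rank F p.+1)) :
  (row_mx a b : 'rV_(cone_rank p.+2)) *m res_diff cone p.+1 =
  row_mx (a *m res_diff F p.+1 + f *: b) (- (b *m res_diff F p)).
Proof. by rewrite /= mul_row_block mul_mx_scalar mulmx0 add0r mulmxN. Qed.

End Cone.

Section ConeResolution.
Variables (K : fieldType) (N : nat) (I : {mpoly K[N]} -> Prop).
Variables (F : free_sequence K N) (f : {mpoly K[N]}) (d : int).
Hypothesis F_res : minimal_resolution I F.
Hypothesis f_homog : homog_of_deg d f.
Hypothesis d_gt0 : (0 < d)%R.
Hypothesis f_nzd : nonzerodivisor I f.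
Hypothesis I_proper : forall g, I g -> g@_0%MM = 0.

Let aug_homog := augm_homog F_res.
Let diff_homog := diff_homog F_res.
Let aug_image := augm_image F_res.
Let exact0 := exact_at_0 F_res.
Let exactS := exact_at_S F_res.

Let homog_scalar r (s : 'I_r -> int) k l :
  homog_of_deg (s k + d - s l) ((f%:M : 'M[{mpoly K[N]}]_r) k l).
Proof.
rewrite mxE; case: eqP => [->|_]; last exact: homog0.
by rewrite mulr1n addrAC subrr add0r.
Qed.

Let const0_scalar r k l : ((f%:M : 'M[{mpoly K[N]}]_r) k l)@_0%MM = 0.
Proof.
rewrite mxE; case: eqP => [_|_]; last exact: mcoeff0.
by rewrite mulr1n (homog_mcoeff0 f_homog) // gt_eqF.
Qed.

Lemma cone_shift_homog p k l :
  homog_of_deg (res_shift k - res_shift l) (res_diff (cone F f d) p k l).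
Proof.
case: p k l => [|p] k l /=; rewrite !mxE; case: (split k) => i; rewrite !mxE;
    case: (split l) => j; rewrite ?ord1.
- exact: diff_homog.
- by rewrite mxE; apply: homog0.
- exact: homog_scalar.
- by rewrite mxE addrK; apply/homogN/aug_homog.
- exact: diff_homog.
- by rewrite mxE; apply: homog0.
- exact: homog_scalar.
- by rewrite mxE opprD addrACA subrr addr0; apply/homogN/diff_homog.
Qed.

(** Besides differentials of F, the blocks are f, of positive degree, and the augmentation, whose
    entries lie in I; none has a constant term. *)
Lemma cone_const0 p k l : (res_diff (cone F f d) p k l)@_0%MM = 0.
Proof.
have aug0 i j : (res_aug F i j)@_0%MM = 0.
  apply: I_proper; apply/aug_image; exists (delta_mx 0 i).
  by rewrite -rowE mxE ord1.
case: p k l => [|p] k l /=; rewrite !mxE; case: (split k) => i; rewrite !mxE;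
    case: (split l) => j; rewrite ?const0_scalar ?(diff_minimal F_res) //;
    rewrite mxE ?mcoeff0 // mcoeffN ?aug0 ?(diff_minimal F_res) ?oppr0 //.
Qed.

(** For a cycle (a, b), lift b to c one step up; then a + f c is a cycle of F and lifts to e, and
    (e, - c) maps to (a, b). *)
Lemma cone_minimal : minimal_resolution (add_generator I f) (cone F f d).
Proof.
split.
- move=> k; rewrite /= mxE; case: (split k) => i; first exact: aug_homog.
  by rewrite mxE !ord1.
- exact: cone_shift_homog.
- move=> h; split=> [[i [g [/aug_image[a ->] ->]]] | [u ->]].
    exists (row_mx a g%:M); rewrite cone_row_aug [RHS]mxE; congr (_ + _).
    by rewrite !mxE mulr1n mulrC.
  rewrite -[u]hsubmxK cone_row_aug.
  exists ((lsubmx u *m res_aug F) 0 0), (rsubmx u 0 0); split.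
    by apply/aug_image; exists (lsubmx u).
  by rewrite mxE [X in _ + X]mxE mulrC.
- move=> u; split=> [|[v ->]]; last first.
    rewrite -[v]hsubmxK cone_row_diff0 cone_row_aug mulmxDl -scalemxAl scalerN.
    by rewrite addrK; apply/exact0; eexists.
  rewrite -[u]hsubmxK; move: (lsubmx u) (rsubmx u) => a b.
  rewrite cone_row_aug => eq0.
  (* In degree 0 the lift of b exists because f is a nonzerodivisor modulo I: the cycle condition
     puts f b in I. *)
  have [c eq_b] : exists c, b = c *m res_aug F.
    have /aug_image[c eq_c] : I (b 0 0).
      apply/f_nzd/aug_image; exists (- a).
      move/eqP: eq0; rewrite addrC addr_eq0 -mulNmx => /eqP <-.
      by rewrite mxE.
    by exists c; apply/rowP => j; rewrite ord1.
  have /exact0[e eq_e] : (a + f *: c) *m res_aug F = 0.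
    by rewrite mulmxDl -scalemxAl -eq_b.
  exists (row_mx e (- c)); rewrite cone_row_diff0 -eq_e scalerN addrK.
  by rewrite mulNmx opprK -eq_b.
- case=> [|p] u; split=> [|[v ->]].
  + rewrite -[u]hsubmxK; move: (lsubmx u) (rsubmx u) => a b.
    rewrite cone_row_diff0 -row_mx0 => /eq_row_mx[eq0 /eqP].
    rewrite oppr_eq0 => /eqP/exact0[c eq_b].
    have /exactS[e eq_e] : (a + f *: c) *m res_diff F 0 = 0.
      by rewrite mulmxDl -scalemxAl -eq_b.
    exists (row_mx e (- c)); rewrite cone_row_diffS -eq_e scalerN addrK.
    by rewrite mulNmx opprK -eq_b.
  + rewrite -[v]hsubmxK cone_row_diffS cone_row_diff0 mulmxDl -scalemxAl.
    rewrite scalerN addrK mulNmx opprK.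
    have -> : lsubmx v *m res_diff F 1 *m res_diff F 0 = 0.
      by apply/exactS; eexists.
    have -> : rsubmx v *m res_diff F 0 *m res_aug F = 0.
      by apply/exact0; eexists.
    exact: row_mx0.
  + rewrite -[u]hsubmxK; move: (lsubmx u) (rsubmx u) => a b.
    rewrite cone_row_diffS -row_mx0 => /eq_row_mx[eq0 /eqP].
    rewrite oppr_eq0 => /eqP/exactS[c eq_b].
    have /exactS[e eq_e] : (a + f *: c) *m res_diff F p.+1 = 0.
      by rewrite mulmxDl -scalemxAl -eq_b.
    exists (row_mx e (- c)); rewrite cone_row_diffS -eq_e scalerN addrK.
    by rewrite mulNmx opprK -eq_b.
  + rewrite -[v]hsubmxK !cone_row_diffS mulmxDl -scalemxAl scalerN.
    rewrite addrK mulNmx opprK.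
    have -> : lsubmx v *m res_diff F p.+2 *m res_diff F p.+1 = 0.
      by apply/exactS; eexists.
    have -> : rsubmx v *m res_diff F p.+1 *m res_diff F p = 0.
      by apply/exactS; eexists.
    exact: row_mx0.
- exact: cone_const0.
Qed.

End ConeResolution.

(** A shift s of F in degree p occurs in the cone as s in degree p and as s + d in degree p + 1,
    contributing s - p and s - p + d - 1. The new generator contributes d, which is at most t + d -
    1 as t > 0. *)
Lemma regularity_add_generator (K : fieldType) (N : nat)
    (I : {mpoly K[N]} -> Prop) f (d t : int) :
    homog_of_deg d f -> (0 < d)%R -> (0 < t)%R -> nonzerodivisor I f ->
    (forall g, I g -> g@_0%MM = 0) ->
  has_regularity I t -> has_regularity (add_generator I f) (t + d - 1).
Proof.
move=> f_d d_gt0 t_gt0 f_nzd I_proper [F [F_res F_le [p [k F_eq]]]].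
exists (cone F f d); split; first exact: cone_minimal.
  case=> [|q] l; rewrite /=; case: (split l) => i; try have := F_le _ i; lia.
exists p.+1, (rshift _ k : 'I_(cone_rank F p.+1)).
by move: F_eq => /=; rewrite (unsplitK (inr _ k)); lia.
Qed.

Lemma eq_has_regularity (K : fieldType) (N : nat)
    (I J : {mpoly K[N]} -> Prop) (t : int) :
  (forall f, I f <-> J f) -> has_regularity I t -> has_regularity J t.
Proof.
move=> eqIJ [F [[F1 F2 F3 F4 F5 F6] F_le F_eq]]; exists F; split=> //.
by split=> // f; rewrite -eqIJ.
Qed.

(** * Variables free for an ideal, and edge binomials as nonzerodivisors *)

Section FreeVariables.
Variables (K : fieldType) (N : nat).
Implicit Types (I : {mpoly K[N]} -> Prop) (f g : {mpoly K[N]}) (v w : 'I_N).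

Definition ideal_pred I : Prop :=
  [/\ I 0, forall f g, I f -> I g -> I (f + g) & forall f g, I g -> I (f * g)].

(** Both conditions hold for an ideal generated by polynomials without X_v; this form avoids naming
    generators. *)
Definition free_var I v : Prop :=
  (forall f, I f -> I (var0 v f)) /\ nonzerodivisor I 'X_v.

Lemma idealB I f g : ideal_pred I -> I f -> I g -> I (f - g).
Proof.
by case=> _ ID IM If Ig; rewrite -mulN1r; apply: ID => //; apply: IM.
Qed.

Lemma idealD_cancel I f g : ideal_pred I -> I g -> I (f + g) -> I f.
Proof. by move=> idI Ig Ifg; rewrite -[f](addrK g); apply: idealB. Qed.

Lemma add_generator_ideal I f : ideal_pred I -> ideal_pred (add_generator I f).
Proof.
case=> I0 ID IM; split.
- by exists 0, 0; rewrite mul0r addr0.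
- move=> _ _ [i [g [Ii ->]]] [j [h [Ij ->]]].
  by exists (i + j), (g + h); split; [exact: ID | ring].
- move=> c _ [i [g [Ii ->]]]; exists (c * i), (c * g).
  by split; [exact: IM | ring].
Qed.

Lemma free_var_divvar I v f : ideal_pred I -> free_var I v -> I f ->
  I (divvar v f).
Proof.
move=> idI [I0 Iv] If; apply: Iv.
rewrite -[_ * _](addKr (var0 v f)) -var0_divvar addrC.
by apply: idealB => //; apply: I0.
Qed.

(** Setting X_v = 0 in X_v h = i + g f gives 0 = i_0 + g_0 f; after subtraction X_v cancels, leaving
    h = i' + g' f. *)
Lemma free_var_add_generator I f v : ideal_pred I -> free_var I v ->
  var0 v f = f -> free_var (add_generator I f) v.
Proof.
move=> idI Iv vf; split.
  move=> _ [i [g [Ii ->]]]; exists (var0 v i), (var0 v g).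
  by rewrite rmorphD rmorphM /= vf; split=> //; apply: Iv.1.
move=> h [i [g [Ii eq_h]]].
exists (divvar v i), (divvar v g); split; first exact: free_var_divvar.
have eq0 : var0 v i + var0 v g * f = 0.
  by rewrite -[f in LHS]vf -rmorphM -rmorphD -eq_h rmorphM /= var0X_id mul0r.
apply: (@mulXI K N v) => /=; rewrite eq_h {1}(var0_divvar v i).
rewrite {1}(var0_divvar v g).
apply/eqP; rewrite -subr_eq0; apply/eqP; rewrite -[RHS]eq0.
ring.
Qed.

Section EdgeGenerator.
Variables (I : {mpoly K[N]} -> Prop) (v1 v2 w1 w2 : 'I_N).
Hypothesis idI : ideal_pred I.
Hypothesis w1_free : free_var I w1.
Hypothesis w2_free : free_var I w2.
Hypothesis v1_nzd : nonzerodivisor I 'X_v1.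
Hypothesis neq : [/\ v1 != w1, v2 != w1 & w2 != w1].

(** For the edge {v, w}, [v1] and [v2] stand for x_v and y_v, and [w1] and [w2] for x_w and y_w. *)
Let f : {mpoly K[N]} := 'X_v1 * 'X_w2 - 'X_w1 * 'X_v2.

Let var0_f : var0 w1 f = 'X_v1 * 'X_w2.
Proof.
case: neq => ? ? ?.
by rewrite rmorphB !rmorphM /= var0X_id mul0r subr0 !var0X_neq.
Qed.

(** Setting X_w1 = 0 turns f into X_v1 X_w2, a product of nonzerodivisors, so g_0 lies in I. Then
    X_w1 cancels from f (g - g_0), leaving f g' in I with g' of smaller degree. *)
Lemma edge_nonzerodivisor : nonzerodivisor I f.
Proof.
move=> g; move: {2}(msize g) (leqnn (msize g)) => k.
have [I0 ID IM] := idI.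
elim: k g => [|k IHk] g gk Ifg.
  by move: gk; rewrite leqn0 msize_poly_eq0 => /eqP->.
have Ig0 : I (var0 w1 g).
  apply/w2_free.2/v1_nzd; have := w1_free.1 _ Ifg.
  by rewrite rmorphM /= var0_f mulrA.
rewrite (var0_divvar w1 g); apply: ID => //; apply/IM/IHk.
  exact: msize_divvar.
apply: w1_free.2; apply: (@idealD_cancel _ _ (f * var0 w1 g)) => //.
  exact: IM.
by move: Ifg; rewrite {1}(var0_divvar w1 g); congr I; ring.
Qed.

(** As before, X_w1 = 0 in X_w1 h = i + g f forces g_0 into I, so X_w1 (h - g' f) lies in I and X_w1
    cancels. The new vertex can thus carry the next path edge. *)
Lemma new_vertex_nonzerodivisor : nonzerodivisor (add_generator I f) 'X_w1.
Proof.
move=> h [i [g [Ii eq_h]]]; have [I0 ID IM] := idI.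
have Ig0 : I (var0 w1 g).
  apply/w2_free.2/v1_nzd.
  have : I (var0 w1 i + var0 w1 g * ('X_v1 * 'X_w2)).
    by rewrite -var0_f -rmorphM -rmorphD -eq_h rmorphM /= var0X_id mul0r.
  rewrite addrC => /(idealD_cancel idI (w1_free.1 _ Ii)).
  by congr I; ring.
exists (h - divvar w1 g * f), (divvar w1 g); split; last by rewrite subrK.
apply: w1_free.2.
rewrite (_ : _ * _ = i + f * var0 w1 g); first by apply: ID => //; apply: IM.
rewrite mulrBr eq_h {1}(var0_divvar w1 g); ring.
Qed.

End EdgeGenerator.

End FreeVariables.

(** * Ideals of 2-minors *)

Section KoszulMinors.
Variables (R : comNzRingType) (z w : nat -> R).

(** The witness is the i-th standard basis vector, one vector for both rows. *)
Lemma koszul_unit m i : (i < m)%N -> exists a : 'rV_(ext_rank 1 m),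
  (a *m koszul z m 0) 0 0 = z i /\ (a *m koszul w m 0) 0 0 = w i.
Proof.
elim: m => // m IHm; rewrite ltnS leq_eqVlt => /orP[/eqP->|/IHm[a [az aw]]].
  exists (row_mx 0 1%:M); rewrite !koszul_row0 !mul0mx !add0r.
  by split; rewrite !mxE mulr1.
exists (row_mx a 0); rewrite !koszul_row0.
by rewrite !scaler0 !addr0.
Qed.

(** Here a weighs the minors of the first m columns, and b those that involve column m. *)
Lemma koszul_rowxy m (a : 'rV_(ext_rank 2 m)) (b : 'rV_(ext_rank 1 m)) :
  ((row_mx a b : 'rV_(ext_rank 2 m.+1)) *m koszul z m.+1 1 *m koszul w m.+1 0)
    0 0 =
  (a *m koszul z m 1 *m koszul w m 0) 0 0
  + (z m * (b *m koszul w m 0) 0 0 - w m * (b *m koszul z m 0) 0 0).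
Proof.
rewrite koszul_rowS koszul_row0 mulmxDl -scalemxAl scalerN -addrA.
move: (a *m _ *m _) (b *m koszul w m 0) (b *m koszul z m 0) => A B C.
by rewrite !mxE.
Qed.

Lemma minor_koszul m i j : (i < j < m)%N -> exists c : 'rV_(ext_rank 2 m),
  (c *m koszul z m 1 *m koszul w m 0) 0 0 = z i * w j - z j * w i.
Proof.
elim: m => [|m IHm]; first by rewrite ltn0 andbF.
rewrite ltnS => /andP[ij]; rewrite leq_eqVlt => /orP[/eqP eq_j|jm].
  have [|a [az aw]] := @koszul_unit m i; first by rewrite -eq_j.
  exists (row_mx 0 (- a)); rewrite koszul_rowxy !mul0mx mxE add0r !mulNmx.
  by rewrite (mxE _ _ 0 0) [X in _ - _ * X]mxE az aw -eq_j; ring.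
have [|c eq_c] := IHm; first by rewrite ij.
exists (row_mx c 0); rewrite koszul_rowxy !mul0mx eq_c.
by rewrite !mxE !mulr0 subrr addr0.
Qed.

Lemma koszul_minors_min (P : R -> Prop) m (c : 'rV_(ext_rank 2 m)) :
    P 0 -> (forall f g, P f -> P g -> P (f + g)) ->
    (forall f g, P g -> P (f * g)) ->
    (forall i j, (i < j < m)%N -> P (z i * w j - z j * w i)) ->
  P ((c *m koszul z m 1 *m koszul w m 0) 0 0).
Proof.
move=> P0 PD PM; elim: m c => [|m IHm] c Pminor.
  by rewrite [c]thinmx0 !mul0mx mxE.
elim/ext_split: c => a b; rewrite koszul_rowxy; apply: (PD).
  by apply: IHm => i j /andP[ij jm]; apply: Pminor; rewrite ij ltnW.
(* Column m stays fixed while the other column of the minor ranges over the first k. *)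
suff Pb k (b' : 'rV_(ext_rank 1 k)) : (k <= m)%N ->
    P (z m * (b' *m koszul w k 0) 0 0 - w m * (b' *m koszul z k 0) 0 0).
  exact: Pb.
elim: k b' => [|k IHk] b' km.
  by rewrite [b']thinmx0 !mul0mx mxE !mulr0 subrr.
elim/ext_split: b' => b1 b2; rewrite !koszul_row0.
have IH := IHk b1 (ltnW km).
rewrite (_ : _ - _ = (z m * (b1 *m koszul w k 0) 0 0
                      - w m * (b1 *m koszul z k 0) 0 0)
  + - b2 0 0 * (z k * w m - z m * w k)).
  by apply/PD/PM/Pminor; rewrite ?km //= ltnSn.
move: (b1 *m koszul w k 0) (b1 *m koszul z k 0) => B C.
by rewrite !mxE; ring.
Qed.

End KoszulMinors.

Section KoszulIdeal.
Variables (K : fieldType) (N : nat) (vx vy : nat -> 'I_N).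
Local Notation kos v := (koszul (fun i => 'X_(v i) : {mpoly K[N]})).

Definition minors_ideal m (f : {mpoly K[N]}) : Prop :=
  exists c : 'rV_(ext_rank 2 m), f = (c *m kos vx m 1 *m kos vy m 0) 0 0.

Lemma minors_ideal_pred m : ideal_pred (minors_ideal m).
Proof.
split.
- by exists 0; rewrite !mul0mx mxE.
- by move=> _ _ [c ->] [e ->]; exists (c + e); rewrite !mulmxDl [RHS]mxE.
- by move=> f _ [c ->]; exists (f *: c); rewrite -!scalemxAl [RHS]mxE.
Qed.

Lemma minors_ideal_free m v :
    (forall i, (i < m)%N -> vx i != v) -> (forall i, (i < m)%N -> vy i != v) ->
  free_var (minors_ideal m) v.
Proof.
move=> vxv vyv; have vA : map_mx (var0 v) (kos vx m 1 *m kos vy m 0) =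
    kos vx m 1 *m kos vy m 0 by rewrite map_mxM !var0_koszul.
split=> [_ [c ->]|f [c eq_f]].
  exists (map_mx (var0 v) c); rewrite -!mulmxA -[in RHS]vA -map_mxM.
  by rewrite [RHS]mxE.
have [|eq_c _] := @divX_mulmx _ _ v _ _ _ (f%:M : 'M_1) c _ vA.
  by apply/rowP => j; rewrite ord1 mulmxA -eq_f !mxE mulr1n.
by exists (map_mx (divvar v) c); rewrite -mulmxA -eq_c mxE mulr1n.
Qed.

(** Let x, y be the last column. Setting x = 0 in x f = a d_x d_y + x (b d_y) - y (b d_x) gives y
    (b_0 d_x) = a_0 d_x d_y. Dividing by y and using exactness of d_x yields b_0 d_y = e d_x d_y;
    now x cancels and f is a combination of minors. *)
Lemma minors_ideal_nonzerodivisor m :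
    (forall i j, (i < j < m.+1)%N -> vx i != vx j) ->
    (forall i j, (i < j < m.+1)%N -> vy i != vy j) ->
    (forall i j, (i < m.+1)%N -> (j < m.+1)%N -> vx i != vy j) ->
  nonzerodivisor (minors_ideal m.+1) 'X_(vx m).
Proof.
move=> vx_inj vy_inj vxy f [c eq_f]; elim/ext_split: c eq_f => a b.
rewrite koszul_rowxy => eq_f.
pose x := vx m; pose y := vy m.
have neq_xy : x != y by apply: vxy.
have xX q : map_mx (var0 x) (kos vx m q) = kos vx m q.
  by apply: var0_koszul => i im; rewrite vx_inj // im ltnSn.
have xY q : map_mx (var0 x) (kos vy m q) = kos vy m q.
  by apply: var0_koszul => i im; rewrite eq_sym vxy // ltnW.
have yX q : map_mx (var0 y) (kos vx m q) = kos vx m q.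
  by apply: var0_koszul => i im; rewrite vxy // ltnW.
have yY q : map_mx (var0 y) (kos vy m q) = kos vy m q.
  by apply: var0_koszul => i im; rewrite vy_inj // im ltnSn.
have eqM : 'X_x *: (f%:M : 'M_1) = a *m kos vx m 1 *m kos vy m 0
    + ('X_x *: (b *m kos vy m 0) - 'X_y *: (b *m kos vx m 0)).
  apply/rowP => j; rewrite ord1; move: eq_f.
  move: (a *m _ *m _) (b *m kos vy m 0) (b *m kos vx m 0) => A B C.
  by rewrite !mxE mulr1n.
have var0E (F A B C : 'M[{mpoly K[N]}]_1) :
    'X_x *: F = A + ('X_x *: B - 'X_y *: C) ->
    map_mx (var0 x) A = 'X_y *: map_mx (var0 x) C.
  move=> /(congr1 (map_mx (var0 x))).
  rewrite map_var0_scaleX map_mxD map_mxB map_var0_scaleX map_mxZ /=.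
  rewrite var0X_neq 1?eq_sym // sub0r.
  by move/esym/eqP; rewrite subr_eq0 => /eqP.
set a0 := map_mx (var0 x) a; set a1 := map_mx (divvar x) a.
set b0 := map_mx (var0 x) b; set b1 := map_mx (divvar x) b.
have eq0 : 'X_y *: (b0 *m kos vx m 0) = a0 *m (kos vx m 1 *m kos vy m 0).
  have := var0E _ _ _ _ eqM; rewrite -mulmxA !map_mxM !xX xY => <-.
  by [].
have [|eq_c _] := divX_mulmx _ eq0; first by rewrite map_mxM yX yY.
set c := map_mx _ a0 in eq_c.
have [||e eq_e] := @koszul_exact _ _ vx m 0 (b0 + c *m kos vy m 1).
- by move=> i j /andP[ij jm]; rewrite vx_inj // ij ltnW.
- rewrite mulmxDl eq_c -[c *m kos vy m 1 *m _]mulmxA koszul_anticomm.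
  by rewrite mulmxN addNr.
have eq_b0 : b0 *m kos vy m 0 = e *m kos vx m 1 *m kos vy m 0.
  by rewrite -eq_e mulmxDl -mulmxA koszul_sq mulmx0 addr0.
exists (row_mx (a1 + e) b1); rewrite koszul_rowxy.
have : (f%:M : 'M_1) = (a1 + e) *m kos vx m 1 *m kos vy m 0
    + ('X_x *: (b1 *m kos vy m 0) - 'X_y *: (b1 *m kos vx m 0)).
  apply: (@scaleXmxI _ _ x) => /=; rewrite eqM.
  rewrite {1}[a](mx_var0_divvar x) [b](mx_var0_divvar x) -/a0 -/a1 -/b0 -/b1.
  rewrite !mulmxDl -!scalemxAl eq_b0 -[a0 *m _ *m _]mulmxA -eq0.
  move: (b0 *m _) (a1 *m _ *m _) (e *m _ *m _) (b1 *m _) (b1 *m _).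
  by move=> A B C D E; apply/rowP => j; rewrite !mxE; ring.
move/(congr1 (fun M : 'M_1 => M 0 0)); rewrite mxE mulr1n => ->.
move: (_ *m _ *m _) (b1 *m kos vy m 0) (b1 *m kos vx m 0) => A B C.
by rewrite !mxE.
Qed.

End KoszulIdeal.

(** * Binomial edge ideals *)

Section BinomialEdgeIdeal.
Variables (K : fieldType) (n : nat) (e : rel 'I_n).

Lemma binomial_edge_ideal_pred : ideal_pred (binomial_edge_ideal K e).
Proof.
split.
- exists (fun _ _ => 0); rewrite big1 // => i _.
  by rewrite big1 // => j; rewrite mul0r.
- move=> _ _ [c ->] [c' ->]; exists (fun i j => c i j + c' i j).
  rewrite -big_split; apply: eq_bigr => i _; rewrite -big_split /=.
  by apply: eq_bigr => j _; rewrite mulrDl.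
- move=> f _ [c ->]; exists (fun i j => f * c i j); rewrite mulr_sumr.
  apply: eq_bigr => i _; rewrite mulr_sumr.
  by apply: eq_bigr => j _; rewrite mulrA.
Qed.

Lemma edge_binomial_in (i j : 'I_n) :
  (i < j)%N -> e i j -> binomial_edge_ideal K e (edge_binomial K i j).
Proof.
move=> ij eij; exists (fun i' j' => ((i' == i) && (j' == j))%:R).
rewrite (bigD1 i) //= (bigD1 j) ?ij //= !eqxx mul1r big1 => [|j' /andP[_]].
  rewrite addr0 big1 ?addr0 // => i' /negbTE->.
  by rewrite big1 // => j' _; rewrite mul0r.
by move=> /negbTE->; rewrite mul0r.
Qed.

Lemma binomial_edge_ideal_min (P : {mpoly K[n + n]} -> Prop) f :
    ideal_pred P ->
    (forall i j : 'I_n, (i < j)%N -> e i j -> P (edge_binomial K i j)) ->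
  binomial_edge_ideal K e f -> P f.
Proof.
case=> P0 PD PM Pe [c ->]; apply: big_ind => // i _; apply: big_ind => // j.
by case/andP=> ij eij; apply/PM/Pe.
Qed.

End BinomialEdgeIdeal.

Lemma ext_rank2_gt0 m : (0 < ext_rank 2 m.+2)%N.
Proof.
rewrite -[ext_rank _ _]/(ext_rank 2 m.+1 + (ext_rank 1 m + 1))%N.
by rewrite !addnS.
Qed.

(** * The clique with a path and its regularity *)

Section CliqueWithPath.
Variables (K : fieldType) (n m : nat).

(** Natural indices allow recursion along the path; [inord] sends those above n to vertex 0, hence
    the bounds in the lemmas below. *)
Let vx (i : nat) : 'I_(n.+1 + n.+1) := lshift n.+1 (inord i).
Let vy (i : nat) : 'I_(n.+1 + n.+1) := rshift n.+1 (inord i).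
Let edge i j : {mpoly K[n.+1 + n.+1]} := edge_binomial K (inord i) (inord j).

(* Clique on 0, ..., m followed by the path m, m + 1, ..., m + k.             *)
Fixpoint clique_path_ideal k : {mpoly K[n.+1 + n.+1]} -> Prop :=
  if k is k'.+1 then
    add_generator (clique_path_ideal k') (edge (m + k') (m + k').+1)
  else minors_ideal vx vy m.+1.

Let vx_neq i j : (i < n.+1)%N -> (j < n.+1)%N -> i != j -> vx i != vx j.
Proof.
move=> ni nj; apply: contra => /eqP/(congr1 val) /=.
by rewrite !inordK // => ->.
Qed.

Let vy_neq i j : (i < n.+1)%N -> (j < n.+1)%N -> i != j -> vy i != vy j.
Proof.
move=> ni nj; apply: contra => /eqP/(congr1 val) /=.
by rewrite !inordK // => /addnI ->.
Qed.

Let vxy_neq i j : vx i != vy j.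
Proof. by rewrite eq_lrshift. Qed.

Let var0_edge v i j : vx i != v -> vx j != v -> vy i != v -> vy j != v ->
  var0 v (edge i j) = edge i j.
Proof.
by move=> xi xj yi yj; rewrite rmorphB !rmorphM /= !var0X_neq.
Qed.

Lemma clique_path_ideal_pred k : ideal_pred (clique_path_ideal k).
Proof.
elim: k => [|k IHk]; first exact: minors_ideal_pred.
exact: add_generator_ideal.
Qed.

Lemma clique_path_ideal_free k j : (m + k < j < n.+1)%N ->
  free_var (clique_path_ideal k) (vx j) /\
  free_var (clique_path_ideal k) (vy j).
Proof.
elim: k => [|k IHk] /andP[kj jn].
  split; apply: minors_ideal_free => i im; rewrite ?[vy _ == vx _]eq_sym //;
    by [apply: vx_neq => //; lia | apply: vy_neq => //; lia].
have [|Ix Iy] := IHk; first by lia.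
split; apply: free_var_add_generator => //; try exact: clique_path_ideal_pred;
  apply: var0_edge; rewrite ?[vy _ == vx _]eq_sym //;
  by [apply: vx_neq => //; lia | apply: vy_neq => //; lia].
Qed.

Lemma clique_path_ideal_nonzerodivisor k : (m + k < n.+1)%N ->
  nonzerodivisor (clique_path_ideal k) 'X_(vx (m + k)).
Proof.
elim: k => [|k IHk] kn.
  rewrite addn0; apply: minors_ideal_nonzerodivisor => i j //.
    by move=> ij; apply: vx_neq; lia.
  by move=> ij; apply: vy_neq; lia.
have [|Ix Iy] := @clique_path_ideal_free k (m + k).+1; first by lia.
rewrite (addnS m k); apply: new_vertex_nonzerodivisor => //.
- exact: clique_path_ideal_pred.
- by apply: IHk; lia.
- by split; rewrite 1?[vy _ == _]eq_sym ?vxy_neq //; apply: vx_neq; lia.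
Qed.

Lemma clique_path_ideal_min k (P : {mpoly K[n.+1 + n.+1]} -> Prop) f :
    ideal_pred P ->
    (forall i j, (i < j <= m)%N -> P (edge i j)) ->
    (forall i, (i < k)%N -> P (edge (m + i) (m + i).+1)) ->
  clique_path_ideal k f -> P f.
Proof.
move=> idP Pclique; have [P0 PD PM] := idP.
elim: k f => [|k IHk] f Ppath; first by case=> c ->; apply: koszul_minors_min.
case=> i [g [Ii ->]]; apply: PD; last by apply/PM/Ppath.
by apply: IHk => // l lk; apply/Ppath/ltnW.
Qed.

Lemma clique_path_ideal_clique k i j :
  (i < j <= m)%N -> clique_path_ideal k (edge i j).
Proof.
move=> ij; elim: k => [|k IHk].
  have [c eq_c] := @minor_koszul {mpoly K[n.+1 + n.+1]} (fun i => 'X_(vx i))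
    (fun i => 'X_(vy i)) m.+1 i j ij.
  by exists c.
by exists (edge i j), 0; rewrite mul0r addr0.
Qed.

Lemma clique_path_ideal_path k i :
  (i < k)%N -> clique_path_ideal k (edge (m + i) (m + i).+1).
Proof.
elim: k => // k IHk; rewrite ltnS leq_eqVlt => /orP[/eqP->|/IHk Ii].
  exists 0, 1; rewrite add0r mul1r; split=> //.
  by case: (clique_path_ideal_pred k).
by exists (edge (m + i) (m + i).+1), 0; rewrite mul0r addr0.
Qed.

Let edge_homog i j : homog_of_deg 2 (edge i j).
Proof.
by apply: homogD; [|apply: homogN]; apply: (@homogM _ _ 1 1); apply: homogX.
Qed.

Lemma clique_path_ideal_proper k f : clique_path_ideal k f -> f@_0%MM = 0.
Proof.
have edge0 i j : (edge i j)@_0%MM = 0.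
  exact: homog_mcoeff0 (@edge_homog i j) _.
apply: (@clique_path_ideal_min k (fun g => g@_0%MM = 0)) => //.
split=> [|g h g0 h0|g h h0]; first exact: mcoeff0.
  by rewrite mcoeffD g0 h0 addr0.
by rewrite rmorphM /= h0 mulr0.
Qed.

Lemma clique_path_ideal_regularity k : (0 < m)%N -> (m + k < n.+1)%N ->
  has_regularity (clique_path_ideal k) (2 + k%:Z).
Proof.
move=> m_gt0; elim: k => [|k IHk] kn.
  exists (eagon_northcott K vx vy m.+1); split.
  - apply: eagon_northcott_minimal => i j //.
      by move=> ij; apply: vx_neq; lia.
    by move=> ij; apply: vy_neq; lia.
  - by move=> p l /=; lia.
  (* With at least two columns there is a quadric generator, which attains the value 2 in degree
     0. *)
  have rank_gt0 : (0 < 1 * ext_rank 2 m.+1)%N.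
    by case: m m_gt0 => // m' _; rewrite mul1n ext_rank2_gt0.
  by exists 0%N, (Ordinal rank_gt0).
have [|Ix Iy] := @clique_path_ideal_free k (m + k).+1; first by lia.
have -> : 2 + k.+1%:Z = (2 + k%:Z) + 2 - 1 by lia.
apply: regularity_add_generator => //; last by apply: IHk; lia.
- apply: edge_nonzerodivisor => //.
  + exact: clique_path_ideal_pred.
  + by apply: clique_path_ideal_nonzerodivisor; lia.
  + by split; rewrite 1?[vy _ == _]eq_sym ?vxy_neq //; apply: vx_neq; lia.
- exact: clique_path_ideal_proper.
Qed.

End CliqueWithPath.

Theorem mainTheorem5 (K : fieldType) (n t : nat) (h3t : (3 <= t)%N)
    (htn : (t <= n)%N) :
  exists e : rel 'I_n,
    [/\ simple_graph e,
        connected_graph e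
      & has_regularity (binomial_edge_ideal K e) (Posz t)].
Proof.
case: n htn => [|n] htn; first by lia.
(* The graph now has [n.+1] vertices. The clique on 0, ..., m contains an edge because t <= n + 1,
   and the k path edges end at vertex m + k = n. *)
pose m := (n.+2 - t)%N; pose k := (t - 2)%N.
have mk : (m + k = n)%N by lia.
pose e (i j : 'I_n.+1) := (i != j) &&
  [|| (i <= m)%N && (j <= m)%N, j == i.+1 :> nat | i == j.+1 :> nat].
have e_sym : ssrbool.symmetric e.
  move=> i j; rewrite /e eq_sym [(i <= m)%N && _]andbC.
  by congr (_ && (_ || _)); rewrite orbC.
exists e; split.
- by split=> // i; rewrite /e eqxx.
- split=> // i j; have conn0 (l : 'I_n.+1) : connect e ord0 l.
    case: l => l ln; elim: l ln => [|l IHl] ln.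
      by rewrite (_ : Ordinal ln = ord0) ?connect0 //; apply/val_inj.
    apply: connect_trans (IHl (ltnW ln)) (connect1 _).
    by rewrite /e /= -val_eqE /= eqxx orbT andbT neq_ltn ltnSn.
  by rewrite (connect_trans _ (conn0 j)) // (sym_connect_sym e_sym).
have -> : Posz t = 2 + k%:Z by lia.
have m_gt0 : (0 < m)%N by lia.
have kn : (m + k < n.+1)%N by rewrite mk.
apply: eq_has_regularity (clique_path_ideal_regularity K m_gt0 kn).
move=> f; split.
  apply: clique_path_ideal_min => [|i j /andP[ij jm]|i ik].
  - exact: binomial_edge_ideal_pred.
  - apply: edge_binomial_in; rewrite ?inordK; try lia.
    by rewrite /e -val_eqE /= !inordK; lia.
  - apply: edge_binomial_in; rewrite ?inordK; try lia.
    by rewrite /e -val_eqE /= !inordK; lia.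
apply: binomial_edge_ideal_min => [|i j ij eij].
  exact: clique_path_ideal_pred.
rewrite -[i]inord_val -[j]inord_val; have [jm|mj] := leqP j m.
  by apply: clique_path_ideal_clique; rewrite ij.
(* An edge with j > m joins consecutive vertices, so j = i + 1 and i >= m: it is a path edge. *)
have -> : nat_of_ord j = (m + (i - m)).+1.
  by move: eij; rewrite /e; lia.
rewrite {1}(_ : nat_of_ord i = (m + (i - m))%N).
  apply: clique_path_ideal_path; have := ltn_ord j.
  by move: eij; rewrite /e; lia.
by move: eij; rewrite /e; lia.
Qed.
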